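(* Let $(Y,d)$ be a metric space, let $Y' \subset Y$ be a non-empty subset, and let $F \colon Y' \to Y$ be a mapping, regarded as a partial map on $Y$ with $\operatorname{dom} F = Y'$, and let $Y$ be equipped with the cost function $c = d$. For any subset $A \subset Y - Y'$ with $A \cap \operatorname{Im} F \neq \emptyset$, the families $(A_{F,\varepsilon})_{\varepsilon \in \mathbb{R}}$ and $(A_{F,\varepsilon_{\Sigma}})_{\varepsilon \in \mathbb{R}}$ with respect to $d$ are filtrations on $Y$.
   Context: Filtration: a family $(F_i)_{i\in I}$ of subsets of a set $Y$ indexed by a totally ordered set $I$ is a filtration (on $Y$) if $Y=\bigcup_{i\in I}F_i$ and $F_{i_1}\subseteq F_{i_2}$ whenever $i_1\le i_2$. Partial maps and costs: a partial map $F\colon Y\rightharpoonup Y$ is a map from a subset $\operatorname{dom}F\subseteq Y$ to $Y$; $\operatorname{Im}F=F(\operatorname{dom}F)$. A cost function on $Y$ is a function $c\colon Y\times Y\to[0,\infty]$ with $c(y,y)=0$ for all $y$ (e.g. a metric). Reachable sets: let $\varepsilon\in[0,\infty]$ and $y\in Y$. The set $[y]_F^{\varepsilon}$ consists of $y$ itself (path of length $0$) together with all points of the form $F(y_{n-1})$, where $n\ge 1$ and $(y_0,\dots,y_{n-1})\in(\operatorname{dom}F)^n$ satisfies $c(y,y_0)\le\varepsilon$ and $c(F(y_i),y_{i+1})\le\varepsilon$ for all $0\le i\le n-2$. The set $[y]_F^{\varepsilon_\Sigma}$ consists of $y$ itself together with all points of the form $F(y_{n-1})$, where $n\ge1$,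 $(y_0,\dots,y_{n-1})\in(\operatorname{dom}F)^n$, and there is $(\varepsilon_0,\dots,\varepsilon_{n-1})\in[0,\infty]^n$ with $\sum_{i=0}^{n-1}\varepsilon_i\le\varepsilon$, $c(y,y_0)\le\varepsilon_0$ and $c(F(y_i),y_{i+1})\le\varepsilon_{i+1}$ for all $0\le i\le n-2$. Attracting basins of $A\subseteq Y$: for $\varepsilon\in[0,\infty]$, $A_{F,\varepsilon}:=\{y\in Y\mid [y]_F^{\varepsilon}\cap A\ne\emptyset\}$. Next, $A_{F,-0}:=\{y\in Y\mid \emptyset\ne[y]_F^{0}\setminus\operatorname{dom}F\subseteq A\}$, and for $\varepsilon\in(0,\infty]$, $A_{F,-\varepsilon}:=\{y\in A_{F,-0}\mid\emptyset\ne[y]_F^{\varepsilon}\setminus\operatorname{dom}F\subseteq A\}$. The sets $A_{F,\varepsilon_\Sigma}$, $A_{F,-0_\Sigma}$, $A_{F,-\varepsilon_\Sigma}$ are defined in the same way with $[y]_F^{\varepsilon_\Sigma}$, $[y]_F^{0_\Sigma}$ in place of $[y]_F^{\varepsilon}$, $[y]_F^{0}$. In a family indexed by $\varepsilon\in\mathbb{R}$, the member of index $0$ is $A_{F,0}$ (resp. $A_{F,0_\Sigma}$), and the member of negative index $-\varepsilon$ ($\varepsilon>0$) is $A_{F,-\varepsilon}$ (resp. $A_{F,-\varepsilon_\Sigma}$). *)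

(* Defs.v *)
From mathcomp Require Import all_boot all_order all_algebra.
From mathcomp Require Import all_classical all_reals topology.

Set Implicit Arguments.
Unset Strict Implicit.
Unset Printing Implicit Defensive.

Import Order.TTheory GRing.Theory Num.Theory.

Local Open Scope classical_set_scope.
Local Open Scope ring_scope.

Definition filtration d (I : orderType d) (Y : Type) (X : I -> set Y) : Prop :=
  \bigcup_i X i = [set: Y] /\
  (forall i1 i2 : I, (i1 <= i2)%O -> X i1 `<=` X i2).

(* [partial_fun] is defined on the subtype of the points of [dom]; hence [Im F]
   is [range F]. *)
Record partial_map (Y : Type) := PartialMap {
  dom : set Y ;
  partial_fun :> dom -> Y
}.

Record cost (R : realType) (Y : Type) := Cost {
  cost_fun :> Y -> Y -> \bar R ;
  cost_ge0 : forall x y, (0 <= cost_fun x y)%E ;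
  costxx : forall y, cost_fun y y = 0%E
}.

Lemma mdistE_ge0 (R : realType) (Y : metricType R) (x y : Y) :
  (0 <= (mdist x y)%:E)%E.
Proof. by rewrite lee_fin mdist_ge0. Qed.

Lemma mdistE_xx (R : realType) (Y : metricType R) (y : Y) :
  (mdist y y)%:E = 0%E.
Proof. by rewrite mdistxx. Qed.

Definition metric_cost (R : realType) (Y : metricType R) : cost R Y :=
  Cost (@mdistE_ge0 R Y) (@mdistE_xx R Y).

Section reachable_sets.
Context (R : realType) (Y : Type) (c : cost R Y) (F : partial_map Y).
Implicit Types (eps : \bar R) (y : Y) (A : set Y).

(* In both definitions a path of length n >= 1 is given by its points
   (p 0, ..., p m), where n = m.+1; the steps are indexed by i < m, with
   [widen_ord (leqnSn m) i] of value i and [lift ord0 i] of value i.+1.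
   The parameter [eps] is meant to range over [0, +oo]. *)

Definition reach eps y : set Y :=
  [set z | z = y \/
    exists (m : nat) (p : 'I_m.+1 -> dom F),
      [/\ (c y (val (p ord0)) <= eps)%E,
          forall i : 'I_m,
            (c (F (p (widen_ord (leqnSn m) i))) (val (p (lift ord0 i)))
               <= eps)%E
        & z = F (p ord_max)]].

Definition reach_sum eps y : set Y :=
  [set z | z = y \/
    exists (m : nat) (p : 'I_m.+1 -> dom F) (e : 'I_m.+1 -> \bar R),
      [/\ (forall i, (0 <= e i)%E) /\ (\sum_(i < m.+1) e i <= eps)%E,
          (c y (val (p ord0)) <= e ord0)%E,
          forall i : 'I_m,
            (c (F (p (widen_ord (leqnSn m) i))) (val (p (lift ord0 i)))
               <= e (lift ord0 i))%E
        & z = F (p ord_max)]].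

(* The basins depend on the reachable sets only through [rch], to be taken
   as [reach] or as [reach_sum]. *)
Section basins.
Context (rch : \bar R -> Y -> set Y).

(* A_{F,eps} for eps in [0, +oo] *)
Definition basin_of A eps : set Y :=
  [set y | rch eps y `&` A !=set0].

(* A_{F,-0} *)
Definition strict_basin0_of A : set Y :=
  [set y | rch 0%E y `\` dom F !=set0 /\ rch 0%E y `\` dom F `<=` A].

(* A_{F,-eps} for eps in ]0, +oo] *)
Definition strict_basin_of A eps : set Y :=
  [set y | strict_basin0_of A y /\
    (rch eps y `\` dom F !=set0 /\ rch eps y `\` dom F `<=` A)].

(* The member of index 0 is A_{F,0}, not A_{F,-0}. *)
Definition basin_family_of A (r : R) : set Y :=
  if 0 <= r then basin_of A r%:E else strict_basin_of A (- r)%:E.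

End basins.

Definition basin_family A : R -> set Y := basin_family_of reach A.

Definition basin_family_sum A : R -> set Y := basin_family_of reach_sum A.

End reachable_sets.

(* Main.v *)
(** Both reachable sets grow with [eps].  If [r < 0 <= s], a point of the
    [r]-th basin reaches at cost [0] a point outside [dom F], which has to lie
    in [A] and is still reachable at cost [s].  The basins exhaust [Y] because
    a point of [A] of the form [F x] is reached from any [y] by one step of
    cost [d(y, x)]. *)
Require Import Defs.
From mathcomp Require Import all_boot all_order all_algebra.
From mathcomp Require Import all_classical all_reals topology.

Set Implicit Arguments.
Unset Strict Implicit.
Unset Printing Implicit Defensive.

Import Order.TTheory GRing.Theory Num.Theory.

Local Open Scope classical_set_scope.
Local Open Scope ring_scope.

Section basins.
Context (R : realType) (Y : Type) (c : cost R Y) (F : partial_map Y).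
Implicit Types (e : \bar R) (y : Y) (A : set Y).

Lemma le_reach e1 e2 y : (e1 <= e2)%E -> reach c F e1 y `<=` reach c F e2 y.
Proof.
move=> le12 z [->|[m [p [c0 cS ->]]]]; first by left.
right; exists m, p; split=> // [|i]; first exact: le_trans le12.
exact: le_trans le12.
Qed.

Lemma le_reach_sum e1 e2 y :
  (e1 <= e2)%E -> reach_sum c F e1 y `<=` reach_sum c F e2 y.
Proof.
move=> le12 z [->|[m [p [e [[e_ge0 sum_e] c0 cS ->]]]]]; first by left.
by right; exists m, p, e; split=> //; split=> //; exact: le_trans le12.
Qed.

(** A one-point path, [m = 0]: the conditions indexed by ['I_0] are vacuous. *)
Lemma reach_step (x : dom F) y : reach c F (c y (val x)) y (F x).
Proof. by right; exists 0%N, (fun=> x); split=> // -[]. Qed.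

Lemma reach_sum_step (x : dom F) y : reach_sum c F (c y (val x)) y (F x).
Proof.
(* The whole budget goes to the only step. *)
right; exists 0%N, (fun=> x), (fun=> c y (val x)); split=> // [|[]//].
by split=> [_|]; [exact: cost_ge0|rewrite big_ord1].
Qed.

(** Serves both families at once: growth in the cost and access to [A] from every point are all that
    is asked of [rch]. The access cost has to be finite and nonnegative, so that it is an index in
    [R] of a basin of the first kind. *)
Lemma basin_family_of_filtration (rch : \bar R -> Y -> set Y) A :
  (forall e1 e2 y, (e1 <= e2)%E -> rch e1 y `<=` rch e2 y) ->
  (forall y, exists2 r : R, 0 <= r & rch r%:E y `&` A !=set0) ->
  filtration (basin_family_of F rch A).
Proof.
move=> le_rch reachA; split.
  apply/seteqP; split=> // y _; have [r r_ge0 rA] := reachA y.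
  by exists r => //; rewrite /basin_family_of r_ge0.
move=> r s le_rs y; rewrite /basin_family_of.
have [r_ge0|r_lt0] := leP 0 r.
  rewrite (le_trans r_ge0 le_rs) => -[z [rz Az]].
  by exists z; split=> //; apply: le_rch rz; rewrite lee_fin.
move=> [[[z [z0 zF]] sub0] [_ subr]].
have [s_ge0|s_lt0] := leP 0 s.
  exists z; split; last exact: sub0.
  by apply: le_rch z0; rewrite lee_fin.
(* Here [r <= s < 0], so the reachable set shrinks from cost [- r] to cost [- s]. The inclusion in
   [A] is inherited; non-emptiness outside [dom F] is not, and comes from [z], reached at cost
   [0]. *)
split; first by split=> //; exists z.
split.
  exists z; split=> //; apply: le_rch z0.
  by rewrite lee_fin oppr_ge0 ltW.
move=> t [st tF]; apply: subr; split=> //.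
by apply: le_rch st; rewrite lee_fin lerN2.
Qed.

End basins.

Theorem theorem1 (R : realType) (Y : metricType R) (Y' : set Y) (F : Y' -> Y)
    (A : set Y) :
  Y' !=set0 ->
  A `<=` ~` Y' ->
  A `&` range F !=set0 ->
  filtration (basin_family (metric_cost Y) (PartialMap F) A) /\
  filtration (basin_family_sum (metric_cost Y) (PartialMap F) A).
Proof.
move=> _ _ [a [Aa [x _ Fxa]]]; rewrite -{}Fxa in Aa.
split; apply: basin_family_of_filtration => [e1 e2 y|y].
- exact: le_reach.
- exists (mdist y (val x)); first exact: mdist_ge0.
  exists (F x); split=> //.
  exact: (@reach_step _ _ (metric_cost Y) (PartialMap F)).
- exact: le_reach_sum.
- exists (mdist y (val x)); first exact: mdist_ge0.
  exists (F x); split=> //.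
  exact: (@reach_sum_step _ _ (metric_cost Y) (PartialMap F)).
Qed.
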